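(* Let $G$ be a connected graph of order $n \geq 4$ (that is, with $n$ vertices). If $|E(G)| \geq \binom{n-2}{2} + 2$, then $rc(G) \leq 3$.
   Context: All graphs are finite and simple. An edge-colored graph $G$ (each edge is assigned a color; adjacent edges may receive the same color) is called rainbow connected if any two vertices of $G$ are connected by a path whose edges have pairwise distinct colors. The rainbow connection number $rc(G)$ of a connected graph $G$ is the smallest number of colors needed in an edge-coloring of $G$ that makes $G$ rainbow connected. $E(G)$ denotes the edge set of $G$. *)

(* Defs.v *)
From mathcomp Require Import all_boot.
From mathcomp Require Import boolp.

Set Implicit Arguments.
Unset Strict Implicit.
Unset Printing Implicit Defensive.

Record sgraph := SGraph {
  vertex :> finType;
  adj : rel vertex;
  adj_sym : symmetric adj;
  adj_irrefl : irreflexive adj }.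

Definition edges (G : sgraph) : {set {set G}} :=
  [set [set xy.1; xy.2] | xy in [pred xy : G * G | adj xy.1 xy.2]].

Definition connected (G : sgraph) : Prop := forall x y : G, connect (@adj G) x y.

(* A path is given by its first vertex x and the sequence p of the following
   ones; x = y is joined to itself by the trivial path p = [::]. *)
Definition is_path (G : sgraph) (x y : G) (p : seq G) : Prop :=
  [/\ path (@adj G) x p, last x p = y & uniq (x :: p)].

Definition path_edges (G : sgraph) (x : G) (p : seq G) : seq {set G} :=
  pairmap (fun u v => [set u; v]) x p.

(* The values of a coloring outside of [edges G] are never used. *)
Definition edge_coloring (G : sgraph) (k : nat) (c : {set G} -> nat) : Prop :=
  {in edges G, forall f, c f < k}.

Definition rainbow_connected (G : sgraph) (c : {set G} -> nat) : Prop :=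
  forall x y : G, exists2 p, is_path x y p & uniq (map c (path_edges x p)).

Definition rainbow_colorable (G : sgraph) (k : nat) : Prop :=
  exists2 c : {set G} -> nat, edge_coloring k c & rainbow_connected c.

Lemma path_edges_sub (G : sgraph) (x : G) p f :
  f \in path_edges x p -> f \subset x :: p.
Proof.
elim: p x => [|y p IHp] x //=; rewrite inE => /orP[/eqP-> | /IHp /subsetP fp].
  by apply/subsetP => z; rewrite !inE => /orP[]->; rewrite ?orbT.
by apply/subsetP => z /fp; rewrite !inE => ->; rewrite orbT.
Qed.

Lemma path_edgesE (G : sgraph) (x : G) p :
  path (@adj G) x p -> {subset path_edges x p <= edges G}.
Proof.
elim: p x => [|y p IHp] x //= /andP[xy yp] f; rewrite inE => /orP[/eqP-> | ].
  by apply/imsetP; exists (x, y).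
exact: IHp.
Qed.

Lemma path_edges_uniq (G : sgraph) (x : G) p :
  uniq (x :: p) -> uniq (path_edges x p).
Proof.
elim: p x => [|y p IHp] x //= /andP[xp yp]; rewrite IHp // andbT.
by apply: contra xp => /path_edges_sub/subsetP; apply; rewrite !inE eqxx.
Qed.

Lemma connected_rainbow_colorable (G : sgraph) :
  connected G -> exists k, `[< rainbow_colorable G k >].
Proof.
move=> cG; exists #|edges G|; apply/asboolP.
exists (fun f => index f (enum (edges G))) => [f fE|x y].
  by rewrite cardE index_mem mem_enum.
have /connectP[p0 p0P ->] := cG x y; case/shortenP: p0P => p xp up _.
exists p; first by [].
rewrite map_inj_in_uniq ?path_edges_uniq // => f g fp gp.
by apply: index_inj; rewrite // mem_enum; apply: path_edgesE xp _ _.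
Qed.

Definition rc (G : sgraph) (cG : connected G) : nat :=
  ex_minn (connected_rainbow_colorable cG).

(* Main.v *)
Require Import Defs.
From mathcomp Require Import all_boot.
From mathcomp Require Import boolp zify.

Set Implicit Arguments.
Unset Strict Implicit.
Unset Printing Implicit Defensive.

(** Let [nh] be twice the number of non-adjacent pairs of vertices. The
    hypothesis on the edges reads [nh <= 4 n - 10], and the theorem is proved
    in this form for the subgraph induced by any vertex set [A] without
    isolated vertices ([colorable3_dense]), by induction on the size [n] of
    [A]. All the rainbow paths have at most three edges.

    Two tools do most of the work. The first extends a coloring to a new
    vertex [v] ([colorable_extend]): if each non-neighbour [y] of [v] is served
    by a common neighbour [g y] of [v] and [y], then only the color of the edge
    from [v] to [g y] has to differ from that of the edge from [g y] to [y].
    With [k] colors this can be arranged as soon as no vertex serves [k] or more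
    non-neighbours. The second says that two colors are enough when
    [nh <= 2 n - 4] ([colorable2_dense]). It follows from the first, since if the least positive number [D] of non-neighbours is
    at least 2, so few pairs are non-adjacent that [D] vertices are universal,
    and then distinct non-neighbours can be served by distinct vertices.

    For three colors the cases are as follows.
    - A vertex of degree 1: the rest satisfies the bound for two colors, and the
      pendant edge receives the third one ([colorable3_pendant]).
    - Two non-adjacent vertices without common neighbour: together they miss so
      many edges that the rest satisfies the bound for two colors, and again the
      third color extends the coloring ([colorable3_far]).
    - Otherwise all degrees are at least 2 and non-adjacent vertices have common
      neighbours. A vertex with 2 or 3 non-neighbours, not all served by a
      single vertex, is then removed by induction and put back with the
      extension tool ([colorable3_few_nonnbs]); removing it lowers [nh] by at
      least 4, as much as the bound [4 n - 10] drops.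
    - A vertex [y] with at most one non-neighbour: the edges at [y] are colored
      0 and 1 according to a maximal independent set, the others with 2, so
      that most vertices reach each other through [y]
      ([colorable3_near_universal]). This fails only if at least 3 neighbours of
      [y] have no neighbour among the neighbours of [y]; then there are at most
      6 vertices and the previous case applies.
    - If all vertices have at least 2 non-neighbours, counting shows that the
      induction step applies to some vertex. *)

(** * Counting non-adjacent pairs *)

Section Dense.
Variable G : sgraph.
Implicit Types (A B : {set G}) (x y z u v w : G) (c : G -> G -> nat) (k : nat).

Let adjC x y : adj x y = adj y x. Proof. exact: adj_sym. Qed.
Let adjxx x : adj x x = false. Proof. exact: adj_irrefl. Qed.

Definition nonadj x y := (x != y) && ~~ adj x y.
Definition nbs A x := [set y in A | adj x y].
Definition nonnbs A x := [set y in A | nonadj x y].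
(** The ordered pairs are counted, so that the sum of the numbers of
    non-neighbours can be used directly. *)
Definition double_nonedges A := \sum_(x in A) #|nonnbs A x|.

Lemma nonadjC x y : nonadj x y = nonadj y x.
Proof. by rewrite /nonadj eq_sym adjC. Qed.

Lemma adj_neq x y : adj x y -> x != y.
Proof. by apply: contraTneq => ->; rewrite adjxx. Qed.

Lemma card_nbs A x : x \in A -> (#|nbs A x| + #|nonnbs A x|).+1 = #|A|.
Proof.
move=> xA; rewrite (cardsD1 x A) xA -(cardsID [set y | adj x y] (A :\ x)).
congr (_ + _).+1; apply: eq_card => y; rewrite !inE /nonadj.
  by case: eqVneq => [->|_]; [rewrite adjxx !andbF|rewrite andbC].
by rewrite (eq_sym x); case: (y == x); case: (y \in A); case: adj.
Qed.

Lemma card_nonnbsD1 A v x : v \in A ->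
  #|nonnbs A x| = nonadj x v + #|nonnbs (A :\ v) x|.
Proof.
move=> vA; rewrite (cardsD1 v) !inE vA /=; congr (_ + _).
by apply: eq_card => y; rewrite !inE; case: (y == v); case: (y \in A).
Qed.

Lemma double_nonedgesD1 A v : v \in A ->
  double_nonedges A = double_nonedges (A :\ v) + 2 * #|nonnbs A v|.
Proof.
move=> vA; rewrite /double_nonedges (big_setD1 v) //=.
rewrite (eq_bigr (fun x => nonadj x v + #|nonnbs (A :\ v) x|)); last first.
  by move=> x _; apply: card_nonnbsD1.
rewrite big_split /=.
suff -> : \sum_(x in A :\ v) nonadj x v = #|nonnbs A v| by lia.
rewrite -sum1_card big_mkcond [RHS]big_mkcond /=; apply: eq_bigr => x _.
by rewrite !inE nonadjC /nonadj eq_sym; case: eqVneq; case: (x \in A); case: adj.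
Qed.

(** * Rainbow paths with at most three edges *)

(** The colors are distinct, and so are the vertices, by [rainbow_path], when
    the ends are distinct and the coloring is symmetric. Having the paths
    explicit makes it easy to reverse them and to put an edge in front. *)
Variant rainbow A c x y : Prop :=
| Rainbow1 of adj x y
| Rainbow2 z of z \in A & adj x z & adj z y & c x z != c z y
| Rainbow3 z w of z \in A & w \in A & adj x z & adj z w & adj w y &
    uniq [:: c x z; c z w; c w y].

Definition colorable k A := exists c,
  [/\ forall x y, c x y = c y x, forall x y, c x y < k
    & {in A &, forall x y, x != y -> rainbow A c x y}].

Lemma rainbow_sym A c x y : (forall x y, c x y = c y x) ->
  rainbow A c x y -> rainbow A c y x.
Proof.
move=> cC [xy|z zA xz zy D|z w zA wA xz zw wy U].
- by apply: Rainbow1; rewrite adjC.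
- by apply: (Rainbow2 zA); rewrite 1?adjC // (cC y z) (cC z x) eq_sym.
apply: (Rainbow3 wA zA); rewrite 1?adjC //.
rewrite -rev_uniq /rev /= (cC z x) (cC w z) (cC y w).
exact: U.
Qed.

Lemma rainbow_mono A B c c' x y : A \subset B -> {in A &, c =2 c'} ->
  x \in A -> y \in A -> rainbow A c x y -> rainbow B c' x y.
Proof.
move=> /subsetP AB cc' xA yA [xy|z zA xz zy D|z w zA wA xz zw wy U].
- exact: Rainbow1.
- by apply: (@Rainbow2 _ _ _ _ z) => //; [apply: AB|rewrite -!cc'].
by apply: (@Rainbow3 _ _ _ _ z w); rewrite -?cc' ?AB.
Qed.

(** * Adding a vertex to a coloring *)

Definition recolor v (f : G -> nat) c x y :=
  if x == v then f y else if y == v then f x else c x y.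

Lemma recolorC v f c : (forall x y, c x y = c y x) ->
  forall x y, recolor v f c x y = recolor v f c y x.
Proof.
move=> cC x y; rewrite /recolor cC.
by case: (eqVneq x v) => xv; case: (eqVneq y v) => yv; rewrite ?xv ?yv.
Qed.

Lemma recolor_lt k v f c : (forall x, f x < k) -> (forall x y, c x y < k) ->
  forall x y, recolor v f c x y < k.
Proof. by move=> fk ck x y; rewrite /recolor; case: ifP => _ //; case: ifP. Qed.

Lemma recolor_at v f c x : recolor v f c v x = f x.
Proof. by rewrite /recolor eqxx. Qed.

Lemma recolor_off A v f c : {in A :\ v &, c =2 recolor v f c}.
Proof.
by move=> x y /setD1P[/negPf xv _] /setD1P[/negPf yv _]; rewrite /recolor xv yv.
Qed.

Lemma rainbow_recolor A v f c x y : x \in A :\ v -> y \in A :\ v ->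
  rainbow (A :\ v) c x y -> rainbow A (recolor v f c) x y.
Proof. by move=> xA yA; apply: rainbow_mono => //; [apply: subD1set|apply: recolor_off]. Qed.

Lemma colorable_recolor k A v f c : v \in A ->
    (forall x y, c x y = c y x) -> (forall x y, c x y < k) ->
    {in A :\ v &, forall x y, x != y -> rainbow (A :\ v) c x y} ->
    (forall x, f x < k) ->
    (forall y, y \in A :\ v -> rainbow A (recolor v f c) v y) ->
  colorable k A.
Proof.
move=> vA cC ck cA fk vP; exists (recolor v f c).
split=> [||x y xA yA xy]; [exact: recolorC|exact: recolor_lt|].
have [xv|xv] := eqVneq x v; first by subst; apply: vP; rewrite !inE eq_sym xy.
have [yv|yv] := eqVneq y v.
  by subst; apply: rainbow_sym; [apply: recolorC|apply: vP; rewrite !inE xy].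
by apply: rainbow_recolor; [..|apply: cA]; rewrite ?inE ?xv ?yv.
Qed.

(** A rainbow path in the colors 0 and 1 has at most two edges, so that an edge
    of color 2 can be put in front of it. *)
Lemma rainbow_prefix A v f c x y : x \in A :\ v -> y \in A :\ v ->
    (forall x y, c x y < 2) -> f x = 2 -> adj v x ->
    {in A :\ v &, forall x y, x != y -> rainbow (A :\ v) c x y} ->
  rainbow A (recolor v f c) v y.
Proof.
move=> xA yA c2 fx vx cA.
have [<-|xy] := eqVneq x y; first exact: Rainbow1.
have inA z : z \in A :\ v -> z \in A by rewrite inE => /andP[].
case: (cA _ _ xA yA xy) => [e|z zA xz zy D|z w zA wA xz zw wy U].
- apply: (Rainbow2 (inA _ xA)) => //.
  by rewrite recolor_at fx -(recolor_off (A := A)) // gtn_eqF.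
- apply: (Rainbow3 (inA _ xA) (inA _ zA)) => //.
  rewrite recolor_at fx -!(recolor_off (A := A)) //= !inE D.
  by rewrite !gtn_eqF.
by exfalso; move: U (c2 x z) (c2 z w) (c2 w y) => /=; rewrite !inE; lia.
Qed.

(** At most [k - 1] colors are forbidden on the edge from [v] to [x], namely those
    of the edges from [x] to the non-neighbours of [v] which [x] serves. *)
Lemma colorable_extend k A v (g : G -> G) : v \in A -> colorable k (A :\ v) ->
    {in nonnbs A v, forall y, [/\ g y \in A, adj v (g y) & adj (g y) y]} ->
    (forall x, #|[set y in nonnbs A v | g y == x]| < k) ->
  colorable k A.
Proof.
move=> vA [c [cC ck cA]] gP fib.
have ex_f x : exists i : 'I_k,
    forall y, y \in nonnbs A v -> g y = x -> c x y != i.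
  (* The forbidden colors. *)
  pose F := [set Ordinal (ck x y) | y in [set y in nonnbs A v | g y == x]].
  have [i iF|noF] := pickP [pred i | i \notin F].
    exists i => y yv gy; apply: contra iF => /eqP yi; apply/imsetP.
    by exists y; [rewrite inE yv gy eqxx|apply: val_inj].
  have: #|F| < #|'I_k| by rewrite card_ord (leq_ltn_trans (leq_imset_card _ _)).
  by rewrite -cardsT ltnNge subset_leq_card //; apply/subsetP => i _; move/negbFE: (noF i).
have [f fP] := fin_all_exists ex_f.
apply: (colorable_recolor (f := fun x => f x) vA cC ck cA) => [x|y yA]; first exact: ltn_ord.
have [vy|vy] := boolP (adj v y); first exact: Rainbow1.
have yc : y \in nonnbs A v.
  by move: yA; rewrite !inE /nonadj vy (eq_sym v) => /andP[-> ->].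
have [gA vg gy] := gP _ yc.
apply: (Rainbow2 gA) => //; rewrite recolor_at -(recolor_off (A := A)) //.
  by rewrite eq_sym fP.
by rewrite !inE gA eq_sym adj_neq.
Qed.


Lemma nonnbs_subD1 A v : nonnbs A v \subset A :\ v.
Proof.
by apply/subsetP => y; rewrite !inE /nonadj (eq_sym v) => /and3P[-> -> _].
Qed.

(** * Two colors *)

(** The vertex to remove is one with the least positive number [D] of
    non-neighbours, which keeps the bound. If [D = 1], a single common neighbour
    is needed. If [D > 1], let [q] be the number of non-universal vertices, among
    which are the removed vertex and its non-neighbours, so [D < q]. From
    [q * D <= 2 * #|A| - 4] there are at least [D] universal vertices, and each
    non-neighbour gets its own one. *)
Lemma colorable2_dense A : double_nonedges A + 4 <= 2 * #|A| -> colorable 2 A.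
Proof.
have [m] := ubnP #|A|; elim: m A => // m IHm A mA hA.
have [w wA|full] := pickP [pred w in A | 0 < #|nonnbs A w|]; last first.
  exists (fun _ _ => 0); split=> // x y xA yA xy; apply: Rainbow1.
  have /(_ x) /= := full; rewrite xA card_gt0 => /negbFE/eqP/setP/(_ y).
  by rewrite !inE yA /nonadj xy => /negbFE.
case: (arg_minnP (P := [pred w in A | 0 < #|nonnbs A w|])
         (fun w => #|nonnbs A w|) wA) => /= v /andP[vA v_gt0] vmin {w wA}.
have cardA := cardsD1 v A; rewrite vA in cardA.
have nE := double_nonedgesD1 vA.
have IHv : colorable 2 (A :\ v) by apply: IHm; lia.
have [v1|v_gt1] := leqP #|nonnbs A v| 1.
  have /cards1P[y vy] : #|nonnbs A v| == 1 by rewrite eqn_leq v1.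
  have yv : y \in nonnbs A v by rewrite vy inE.
  have /setD1P[_ yA] := subsetP (nonnbs_subD1 A v) _ yv.
  have [x /setIP[]|noX] := pickP [in nbs A v :&: nbs A y].
    rewrite !inE => /andP[xA vx] /andP[_ yx].
    apply: (colorable_extend (g := fun=> x) vA IHv) => [z|z].
      by rewrite vy inE => /eqP->; split; rewrite // adjC.
    apply: leq_trans (_ : #|nonnbs A v| < 2); rewrite ?ltnS //.
    by apply: subset_leq_card; apply/subsetP => u; rewrite inE => /andP[].
  (* Without a common neighbour, y would be isolated, which costs too many
     non-adjacent pairs. *)
  have nby0 : #|nbs A y| = 0.
    apply/eqP; rewrite cards_eq0; apply/eqP/setP => x; apply/negP.
    rewrite !inE => /andP[xA yx].
    have [vx|vx] := boolP (adj v x); first by have:= noX x; rewrite /= !inE xA vx yx.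
    have: x \in nonnbs A v.
      rewrite inE xA /nonadj vx; apply/andP; split=> //; apply/andP; split=> //.
      apply/eqP => vx'; move: yv; rewrite inE vx' /nonadj (adjC x) yx.
      by rewrite !andbF.
    by rewrite vy inE => /eqP xy; rewrite xy adjxx in yx.
  by have := double_nonedgesD1 yA; have := card_nbs yA; lia.
pose U := [set x in A | #|nonnbs A x| == 0].
have cardU : #|nonnbs A v| <= #|U|.
  have : #|nonnbs A v| < #|A :\: U|.
    have -> : #|nonnbs A v|.+1 = #|v |: nonnbs A v|.
      by rewrite cardsU1 inE /nonadj eqxx andbF.
    apply/subset_leq_card/subsetP => y /setU1P[->|]; rewrite !inE.
      by rewrite vA -lt0n v_gt0.
    case/andP=> yA vy; rewrite yA andbT -lt0n card_gt0.
    by apply/set0Pn; exists v; rewrite inE vA nonadjC.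
  have : #|A :\: U| * #|nonnbs A v| <= double_nonedges A.
    rewrite /double_nonedges (big_setID U) /= -sum_nat_const.
    apply: leq_trans (leq_addl _ _); apply: leq_sum => x.
    rewrite !inE => /andP[xU xA]; move: xU; rewrite xA -lt0n => xU.
    by apply: vmin; rewrite xA.
  have := cardsID U A; rewrite (setIidPr _); last by apply/subsetP => x; rewrite inE => /andP[].
  by nia.
(* An injection of the non-neighbours of v into the universal vertices. *)
pose g y := nth v (enum U) (index y (enum (nonnbs A v))).
have gidx y : y \in nonnbs A v -> index y (enum (nonnbs A v)) < size (enum U).
  by move=> yv; rewrite -cardE; apply: leq_trans cardU; rewrite cardE index_mem mem_enum.
apply: (colorable_extend (g := g) vA IHv) => [y yv|x].
  have /setD1P[yv' yA] := subsetP (nonnbs_subD1 A v) _ yv.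
  have : g y \in U by rewrite -mem_enum mem_nth ?gidx.
  rewrite inE => /andP[gA /eqP g0].
  have g_full z : z \in A -> g y != z -> adj (g y) z.
    move=> zA gz; apply: contra_eqT g0 => gz'; rewrite -lt0n card_gt0.
    by apply/set0Pn; exists z; rewrite inE zA /nonadj gz.
  split=> //; first rewrite adjC; apply: g_full => //.
    by apply: contraTneq v_gt1 => <-; rewrite g0.
  apply: contra_eqN g0 => /eqP gy; rewrite -lt0n card_gt0; apply/set0Pn.
  by exists v; rewrite inE vA gy nonadjC; move: yv; rewrite inE => /andP[].
rewrite ltnS; apply/card_le1P => y; rewrite inE => /andP[yv /eqP gy] z.
rewrite !inE; apply/andP/eqP => [[zv /eqP gz]|->]; last by rewrite -gy eqxx; move: yv; rewrite inE.
have zc : z \in nonnbs A v by rewrite inE.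
have /eqP: g z = g y by rewrite gz gy.
rewrite /g nth_uniq ?gidx ?enum_uniq // => /eqP.
by apply: index_inj; rewrite ?mem_enum.
Qed.

(** * Three colors *)

(** With [n = #|A|], removing a vertex of degree 1 lowers the bound [4 n - 10] by
    [2 (n - 2)], which leaves the bound [2 (n - 1) - 4] for two colors. *)
Lemma colorable3_pendant A v : v \in A -> #|nbs A v| = 1 ->
  double_nonedges A + 10 <= 4 * #|A| -> colorable 3 A.
Proof.
move=> vA v1 hA; have cardA := cardsD1 v A; rewrite vA in cardA.
have [c [cC c2 cA]] : colorable 2 (A :\ v).
  by apply: colorable2_dense; have := double_nonedgesD1 vA; have := card_nbs vA; lia.
have /cards1P[x vx] : #|nbs A v| == 1 by rewrite v1.
have : x \in nbs A v by rewrite vx inE.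
rewrite inE => /andP[xA xv].
apply: (colorable_recolor (f := fun=> 2) vA cC _ cA) => // [y z|y yA].
  exact: leq_trans (c2 _ _) _.
by apply: (rainbow_prefix (x := x)); rewrite // inE xA andbT inE eq_sym adj_neq.
Qed.

(** Let [P] and [Q] be the disjoint neighbourhoods of [u] and [w], and [K] the
    set of the other vertices. Removing [u] and [w] leaves
    [double_nonedges K + 4 <= 2 * (#|P| + #|Q|)], so [K] has a rainbow coloring
    with two colors, to which the edges at [u] and [w] are added with color 2.
    One edge is an exception: there is an edge from some [a] in [P] to some
    [x0] in [Q], for otherwise the pairs between [P] and [Q] would already break
    the bound on [K]. The edge from [w] to [x0] gets the color among 0 and 1 which
    the edge from [a] to [x0] does not have, and so [u], [a], [x0], [w] is a
    rainbow path. The other vertices are reached from [w] through another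
    element of [Q]. *)
Lemma colorable3_far A u w : u \in A -> w \in A -> nonadj u w ->
    nbs A u :&: nbs A w = set0 -> 0 < #|nbs A u| -> 1 < #|nbs A w| ->
  double_nonedges A + 10 <= 4 * #|A| -> colorable 3 A.
Proof.
move=> uA wA uw disj P0 Q1 hA.
have neq_uw : u != w by case/andP: uw.
have cardA := cardsD1 u A; rewrite uA in cardA.
have wA' : w \in A :\ u by rewrite !inE eq_sym neq_uw.
have uA' : u \in A :\ w by rewrite !inE neq_uw.
have cardA' := cardsD1 w (A :\ u); rewrite wA' in cardA'.
pose K := A :\ u :\ w.
have KE : K = A :\ w :\ u by rewrite /K !setDDl setUC.
have nE : double_nonedges K + 4 <= 2 * (#|nbs A u| + #|nbs A w|).
  have := double_nonedgesD1 wA'; have := double_nonedgesD1 uA.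
  have := card_nonnbsD1 w uA; rewrite nonadjC uw -/K.
  have := card_nbs uA; have := card_nbs wA; lia.
have nbsK x : x \in nbs A u :|: nbs A w -> x \in K.
  rewrite !inE; case/andP: uw => _ uw; case/orP=> /andP[xA e]; rewrite xA andbT.
    by rewrite (eq_sym x u) (adj_neq e) andbT; apply: contraNneq uw => <-.
  rewrite (eq_sym x w) (adj_neq e) /=.
  by apply: contraNneq uw => <-; rewrite adjC.
have nPQ : #|nbs A u| + #|nbs A w| <= #|K|.
  rewrite -cardsUI disj cards0 addn0; apply/subset_leq_card/subsetP => x.
  exact: nbsK.
have [c [cC c2 cK]] : colorable 2 K by apply: colorable2_dense; lia.
have [[a x0]|noE] := pickP [pred ax : G * G |
    [&& ax.1 \in nbs A u, ax.2 \in nbs A w & adj ax.1 ax.2]].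
  move=> /= /and3P[aP x0Q ax0].
  have [x1 x1Q x10] : exists2 x1, x1 \in nbs A w & x1 != x0.
    have /set0Pn[x1 /setD1P[x10 x1Q]] : nbs A w :\ x0 != set0.
      by rewrite -card_gt0; move: Q1; rewrite (cardsD1 x0) x0Q.
    by exists x1.
  pose f x := if x == x0 then 1 - c a x0 else 2.
  have adjQ x : x \in nbs A w -> adj w x by rewrite inE => /andP[].
  have adjP x : x \in nbs A u -> adj u x by rewrite inE => /andP[].
  have inK x : (x \in nbs A u) || (x \in nbs A w) -> x \in K.
    by move=> xPQ; apply: nbsK; rewrite inE.
  have aK : a \in K by rewrite inK ?aP.
  have wP y : y \in K -> rainbow (A :\ u) (recolor w f c) w y.
    move=> yK; apply: (rainbow_prefix (x := x1)) => //; last exact: adjQ.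
      by rewrite inK ?x1Q ?orbT.
    by rewrite /f (negPf x10).
  apply: (colorable_recolor (f := fun=> 2) (c := recolor w f c) uA) => //.
  - exact: recolorC.
  - apply: recolor_lt => [x|x y]; first by rewrite /f; case: ifP => // _; lia.
    exact: leq_trans (c2 x y) _.
  - move=> x y xA yA xy.
    have [xw|xw] := eqVneq x w; first by rewrite xw; apply: wP; rewrite in_setD1 -xw eq_sym xy.
    have [yw|yw] := eqVneq y w.
      rewrite yw; apply: rainbow_sym; first exact: recolorC.
      by apply: wP; rewrite in_setD1 -yw xy.
    have xK : x \in K by rewrite in_setD1 xw.
    have yK : y \in K by rewrite in_setD1 yw.
    by apply: rainbow_recolor => //; apply: cK.
  - move=> y yA; have [->|yw] := eqVneq y w.
      have aw : a != w by move: aK; rewrite !inE => /and3P[].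
      have au : a != u by move: aK; rewrite !inE => /and3P[].
      have x0K : x0 \in K by rewrite inK ?x0Q ?orbT.
      have x0w : x0 != w by move: x0K; rewrite !inE => /and3P[].
      have x0u : x0 != u by move: x0K; rewrite !inE => /and3P[].
      have inA x : x \in K -> x \in A by rewrite !inE => /and3P[].
      have x0_w : adj x0 w by rewrite adjC adjQ.
      apply: (Rainbow3 (inA _ aK) (inA _ x0K) (adjP _ aP) ax0 x0_w).
      rewrite /recolor eqxx (negPf au) (negPf x0u) (negPf aw) (negPf x0w).
      rewrite (eq_sym w) (negPf neq_uw) eqxx /f eqxx /=.
      by case: (c a x0) (c2 a x0) => [|[|]].
    have yK : y \in K by rewrite in_setD1 yw.
    have sub : {in A :\ w &, recolor u (fun=> 2) c =2 recolor u (fun=> 2) (recolor w f c)}.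
      by move=> p q /setD1P[pw _] /setD1P[qw _]; rewrite /recolor (negPf pw) (negPf qw).
    apply: (rainbow_mono _ sub) => //; first exact: subD1set.
      by move: yK; rewrite KE => /setD1P[].
    by apply: (rainbow_prefix (x := a)); rewrite -?KE ?adjP.
have : 2 * (#|nbs A u| * #|nbs A w|) <= double_nonedges K.
  have nPQ' x y : x \in nbs A u -> y \in nbs A w -> nonadj x y.
    move=> xP yQ; have := noE (x, y); rewrite /= xP yQ /nonadj => /= ->.
    by rewrite andbT; apply: contraTneq xP => xy; move/setP/(_ y): disj; rewrite xy inE yQ andbT in_set0 => ->.
  have PK : nbs A u \subset K by apply/subsetP => x xP; rewrite nbsK // inE xP.
  have QK : nbs A w \subset K :\: nbs A u.
    apply/subsetP => x xQ; rewrite inE nbsK ?andbT; last by rewrite inE xQ orbT.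
    by apply/negP => xP; move/setP/(_ x): disj; rewrite inE xP xQ inE.
  rewrite /double_nonedges (big_setID (nbs A u)) /= (setIidPr PK).
  rewrite [X in _ + X](big_setID (nbs A w)) /= (setIidPr QK) mul2n -addnn; apply: leq_add.
    rewrite -sum_nat_const; apply: leq_sum => x xP.
    apply/subset_leq_card/subsetP => y yQ.
    by rewrite inE nPQ' // nbsK // inE yQ orbT.
  apply: leq_trans (leq_addr _ _); rewrite mulnC -sum_nat_const.
  apply: leq_sum => x xQ; apply/subset_leq_card/subsetP => y yP.
  by rewrite inE nonadjC nPQ' // nbsK // inE yP.
by nia.
Qed.

(** Two distinct elements to be chosen in [W] may be taken to cover [I]. *)
Lemma card2_between (T : finType) (I W : {set T}) :
    I \subset W -> #|I| <= 2 -> 1 < #|W| ->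
  exists x1 x2 : T, [/\ x1 \in W, x2 \in W, x1 != x2 & I \subset [set x1; x2]].
Proof.
move=> IW I2 W2.
have PI : [pred J : {set T} | (J \subset W) && (#|J| <= 2)] I by rewrite /= IW.
have [J /maxsetP[/andP[JW J2] Jmax] IJ] := maxset_exists PI.
suff /cards2P[x1 [x2 [x12 JE]]] : #|J| == 2.
  by exists x1, x2; rewrite -JE !(subsetP JW) ?JE ?inE ?eqxx ?orbT //; split; rewrite -?JE.
rewrite eqn_leq J2 leqNgt; apply/negP => J1.
have /subsetPn[x xW xJ] : ~~ (W \subset J).
  by apply: contraL W2 => /subset_leq_card WJ; rewrite -leqNgt; lia.
suff /Jmax/(_ (subsetUr _ _))/setP/(_ x) :
  [pred J : {set T} | (J \subset W) && (#|J| <= 2)] (x |: J).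
  by rewrite !inE eqxx (negPf xJ).
by rewrite /= subUset sub1set xW JW cardsU1 xJ.
Qed.

(** Let [R] be the neighbourhood of [y], [B] a maximal independent subset of [R]
    minus [x2] which contains [x1], and color the edge from [y] to [x] with 1 or 0
    according to whether [x] is in [B], all the other edges with 2. Vertices of
    [R] on different sides of [B] are joined through [y]. For [p] and [q] on the
    same side, a neighbour [b] of [p] on the other side gives the rainbow path
    [p], [b], [y], [q]. By independence and maximality, only [x1] on the side of
    [B] and only [x2] on the other may lack such a neighbour, so one of [p] and
    [q] has one. A non-neighbour of [y] is adjacent to [x1] and [x2], hence reaches
    either side of [R] through [y], by way of the opposite side. *)
Lemma colorable3_near_universal A y x1 x2 : y \in A ->
    x1 \in nbs A y -> x2 \in nbs A y -> x1 != x2 ->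
    {in nbs A y, forall z, nbs A z :&: nbs A y = set0 -> z \in [set x1; x2]} ->
    {in nonnbs A y, forall w, adj w x1 && adj w x2} -> #|nonnbs A y| <= 1 ->
  colorable 3 A.
Proof.
move=> yA x1R x2R x12 isoR w12 y1; set R := nbs A y in x1R x2R isoR *.
pose indep (S : {set G}) := (S \subset R :\ x2) &&
  [forall a in S, forall b in S, ~~ adj a b].
have indep1 : indep [set x1].
  rewrite /indep sub1set in_setD1 x12 x1R.
  by apply/forall_inP => a /set1P->; apply/forall_inP => b /set1P->; rewrite adjxx.
have [B /maxsetP[/andP[BR /forall_inP Bind] Bmax]] := maxset_exists indep1.
rewrite sub1set => x1B.
have x2B : x2 \notin B by apply/negP => /(subsetP BR); rewrite !inE eqxx.
(* A neighbour on the other side. *)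
have partner p : p \in R -> p \notin [set x1; x2] ->
    exists b, [/\ b \in R, adj p b & (b \in B) != (p \in B)].
  move=> pR p12; have [pB|pB] := boolP (p \in B).
    have /set0Pn[b /setIP[]] : nbs A p :&: R != set0 by apply: contraNneq p12 => /isoR->.
    rewrite inE => /andP[_ pb] bR; exists b; split=> //.
    suff /negPf-> : b \notin B by [].
    by apply: contraL pb => bB; apply: (forall_inP (Bind p pB)).
  have [b /andP[bB pb]|nob] := pickP [pred b in B | adj p b].
    by exists b; rewrite bB; split=> //; have /setD1P[] := subsetP BR _ bB.
  suff /Bmax/(_ (subsetUr _ _))/setP/(_ p) : indep (p |: B).
    by rewrite !inE eqxx (negPf pB).
  rewrite /indep subUset sub1set BR andbT !in_setD1 pR andbT.
  move: (p12); rewrite !inE negb_or => /andP[_ ->] /=.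
  have nopB b : b \in B -> adj p b = false by move=> bB; have := nob b; rewrite /= bB.
  apply/forall_inP => a /setU1P[->|aB]; apply/forall_inP => b /setU1P[->|bB].
  - by rewrite adjxx.
  - by rewrite nopB.
  - by rewrite adjC nopB.
  - exact: (forall_inP (Bind a aB)).
pose c := recolor y (fun x => nat_of_bool (x \in B)) (fun _ _ => 2).
have cC p q : c p q = c q p by apply: recolorC.
have Ry p : p \in R -> [/\ p \in A, p != y & adj y p].
  by rewrite inE => /andP[pA yp]; rewrite eq_sym adj_neq.
have cl p : c y p = (p \in B) by rewrite /c recolor_at.
have c2 p q : p != y -> q != y -> c p q = 2.
  by rewrite /c /recolor => /negPf-> /negPf->.
have via p b q : p != y -> b \in R -> q \in R -> adj p b ->
    (b \in B) != (q \in B) -> rainbow A c p q.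
  move=> py /Ry[bA b_y yb] /Ry[qA qy yq] pb bq.
  apply: (Rainbow3 bA yA) => //; first by rewrite adjC.
  by rewrite c2 // (cC b) !cl; case: (b \in B) (q \in B) bq => [] [].
have y_ok p : p \in A -> p != y -> rainbow A c y p.
  move=> pA py; have [yp|yp] := boolP (adj y p); first exact: Rainbow1.
  have /w12/andP[px1 _] : p \in nonnbs A y by rewrite inE pA /nonadj eq_sym py.
  have [x1A x1y yx1] := Ry _ x1R.
  by apply: (Rainbow2 x1A) => //; rewrite 1?adjC // cl x1B cC c2.
have w_ok w p : w \in nonnbs A y -> p \in R -> rainbow A c w p.
  move=> wc pR; have /andP[wx1 wx2] := w12 _ wc.
  have wy : w != y by move: wc; rewrite inE => /and3P[_]; rewrite eq_sym.
  have [pB|pB] := boolP (p \in B).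
    by apply: (via _ x2) => //; rewrite pB (negPf x2B).
  by apply: (via _ x1) => //; rewrite x1B (negPf pB).
exists c; split=> // [p q|p q pA qA pq].
  by rewrite /c /recolor; do ![case: ifP => // _]; case: (_ \in B).
have [py|py] := eqVneq p y; first by rewrite py; apply: y_ok; rewrite // -py eq_sym.
have [qy|qy] := eqVneq q y; first by rewrite qy; apply: rainbow_sym => //; apply: y_ok; rewrite // -qy.
have split_A x : x \in A -> x != y -> x \in R \/ x \in nonnbs A y.
  move=> xA xy; rewrite !inE xA /nonadj (eq_sym y) xy /=.
  by case: adj; [left|right].
case: (split_A p pA py) => pR; case: (split_A q qA qy) => qR; last first.
- by have /card_le1_eqP/(_ p q pR qR) pq' := y1; rewrite pq' eqxx in pq.
- exact: w_ok.
- by apply: rainbow_sym => //; apply: w_ok.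
have [pA' _ yp] := Ry p pR; have [qA' _ yq] := Ry q qR.
have [pqB|pqB] := eqVneq (p \in B) (q \in B); last first.
  apply: (Rainbow2 yA) => //; first by rewrite adjC.
  by rewrite (cC p) !cl; case: (p \in B) (q \in B) pqB => [] [].
have [p12|/(partner p pR)[b [bR pb bp]]] := boolP (p \in [set x1; x2]); last first.
  by apply: (via _ b) => //; rewrite -pqB.
have [q12|/(partner q qR)[b [bR qb bq]]] := boolP (q \in [set x1; x2]); last first.
  by apply: rainbow_sym => //; apply: (via _ b) => //; rewrite pqB.
move: p12 q12 pq pqB; rewrite !inE.
by case/orP=> /eqP-> /orP[]/eqP->; rewrite ?eqxx // x1B (negPf x2B).
Qed.

(** A common neighbour may serve two non-neighbours of [v] but not three. With
    three non-neighbours, one of which has two common neighbours with [v], they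
    need not all be served by the same vertex. *)
Lemma colorable3_few_nonnbs A v : v \in A -> colorable 3 (A :\ v) ->
    {in nonnbs A v, forall y, nbs A v :&: nbs A y != set0} ->
    #|nonnbs A v| <= 3 ->
    #|nonnbs A v| <= 2 \/
      (exists2 y, y \in nonnbs A v & 1 < #|nbs A v :&: nbs A y|) ->
  colorable 3 A.
Proof.
move=> vA IHv diam v3 v2.
pose g0 y := odflt v [pick x in nbs A v :&: nbs A y].
have g0P y : y \in nonnbs A v -> g0 y \in nbs A v :&: nbs A y.
  move=> /diam/set0Pn[x xP]; rewrite /g0; case: pickP => [z //|/(_ x)].
  by rewrite xP.
suff [g gP gfib] : exists2 g : G -> G,
    {in nonnbs A v, forall y, g y \in nbs A v :&: nbs A y} &
    forall x, #|[set y in nonnbs A v | g y == x]| <= 2.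
  apply: (colorable_extend (g := g) vA IHv) => // y /gP.
  by rewrite !inE => /andP[/andP[-> ->] /andP[_]]; rewrite adjC.
have fib_sub (g : G -> G) x : [set y in nonnbs A v | g y == x] \subset nonnbs A v.
  by apply/subsetP => y; rewrite inE => /andP[].
have [v_le2|v_gt2] := leqP #|nonnbs A v| 2.
  exists g0 => // x; exact: leq_trans (subset_leq_card (fib_sub _ _)) _.
case: v2 => [|[y0 y0v y0_2]]; first by rewrite leqNgt v_gt2.
have /set0Pn[y1 /setD1P[y10 y1v]] : nonnbs A v :\ y0 != set0.
  by rewrite -card_gt0; move: v_gt2; rewrite (cardsD1 y0) y0v; lia.
have /set0Pn[x0 /setD1P[x01 x0P]] : (nbs A v :&: nbs A y0) :\ g0 y1 != set0.
  by rewrite -card_gt0; move: y0_2; rewrite (cardsD1 (g0 y1)); case: (_ \in _); lia.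
exists (fun y => if y == y0 then x0 else g0 y) => [y yv|x].
  by case: eqVneq => [->|_] //; apply: g0P.
rewrite -ltnS (leq_trans _ v3) //; apply: proper_card; rewrite properE fib_sub /=.
apply/negP => /subsetP sub; have := sub _ y0v; have := sub _ y1v.
rewrite !inE eqxx (negPf y10) => /andP[_ /eqP e1] /andP[_ /eqP e0].
by rewrite e0 e1 eqxx in x01.
Qed.

Lemma leq_mul_sum (S : {set G}) (F : G -> nat) k :
  {in S, forall x, k <= F x} -> #|S| * k <= \sum_(x in S) F x.
Proof. by move=> kF; rewrite -sum_nat_const; apply: leq_sum. Qed.

(** Isolated vertices are excluded instead of assuming connectedness, since this
    passes to [A :\ v] when all degrees are at least 2. *)
Lemma colorable3_dense A : {in A, forall x, 0 < #|nbs A x|} ->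
  double_nonedges A + 10 <= 4 * #|A| -> colorable 3 A.
Proof.
have [m] := ubnP #|A|; elim: m A => // m IHm A mA deg1 hA.
have [v /andP[vA /eqP v1]|no1] := pickP [pred v in A | #|nbs A v| == 1].
  exact: colorable3_pendant vA v1 hA.
have {deg1 no1} deg2 x : x \in A -> 1 < #|nbs A x|.
  by move=> xA; have := no1 x; have := deg1 x xA; rewrite /= xA /=; lia.
have [[u w] /= /and4P[uA wA uw /eqP disj]|nofar] := pickP [pred uw : G * G |
    [&& uw.1 \in A, uw.2 \in A, nonadj uw.1 uw.2 &
        nbs A uw.1 :&: nbs A uw.2 == set0]].
  by apply: (colorable3_far uA wA uw disj) => //; [apply: ltnW|]; apply: deg2.
have diam x : x \in A -> {in nonnbs A x, forall y, nbs A x :&: nbs A y != set0}.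
  move=> xA y; rewrite inE => /andP[yA xy].
  by have := nofar (x, y); rewrite /= xA yA xy /= => ->.
have ext v : v \in A -> 1 < #|nonnbs A v| <= 3 -> #|nonnbs A v| <= 2 \/
      (exists2 y, y \in nonnbs A v & 1 < #|nbs A v :&: nbs A y|) -> colorable 3 A.
  move=> vA /andP[v2 v3]; apply: colorable3_few_nonnbs => //; last exact: diam.
  have cardA := cardsD1 v A; rewrite vA in cardA.
  apply: IHm => [|x /setD1P[xv xA]|]; [lia| |by have := double_nonedgesD1 vA; lia].
  have -> : nbs (A :\ v) x = nbs A x :\ v by apply/setP => z; rewrite !inE andbA.
  by have := deg2 x xA; rewrite (cardsD1 v (nbs A x)); case: (_ \in _); lia.
have [y /andP[yA y1]|no1] := pickP [pred y in A | #|nonnbs A y| <= 1].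
  (* I: the vertices of R without neighbour in R; W: the candidates for the two
     exceptional vertices of the coloring around y. *)
  pose R := nbs A y.
  pose I := [set z in R | nbs A z :&: R == set0].
  pose W := [set x in R | [forall w in nonnbs A y, adj w x]].
  have cardR := card_nbs yA; rewrite -/R in cardR.
  have yc : y \notin nonnbs A y by rewrite inE /nonadj eqxx andbF.
  have Rc x : x \in A -> x \notin R -> x \in y |: nonnbs A y.
    by move=> xA; rewrite !inE xA /nonadj eq_sym => /= ->; case: eqVneq.
  have nbI z : z \in I -> nbs A z = y |: nonnbs A y.
    rewrite inE => /andP[zR /eqP zI].
    have zA : z \in A by move: zR; rewrite inE => /andP[].
    apply/eqP; rewrite eqEcard cardsU1 yc; apply/andP; split; last first.
      by have := deg2 z zA; lia.
    apply/subsetP => x xz; apply: Rc; first by move: xz; rewrite inE => /andP[].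
    by apply/negP => xR; move/setP/(_ x): zI; rewrite inE xz xR inE.
  have IR : I \subset R by apply/subsetP => z; rewrite inE => /andP[].
  have IW : I \subset W.
    apply/subsetP => z zI; rewrite inE (subsetP IR) //=.
    apply/forall_inP => w wc; have : w \in nbs A z by rewrite nbI // setU1r.
    by rewrite inE adjC => /andP[].
  have W2 : 1 < #|W|.
    have [w wc|nc] := pickP [in nonnbs A y]; last first.
      suff -> : W = R by apply: deg2.
      apply/setP => x; rewrite inE andbC; case: forall_inP => // -[] w.
      by have := nc w; rewrite /= => ->.
    have wy : nonadj y w by move: wc; rewrite inE => /andP[].
    have wA : w \in A by move: wc; rewrite inE => /andP[].
    apply: leq_trans (deg2 w wA) (subset_leq_card _).
    apply/subsetP => x; rewrite inE => /andP[xA wx].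
    have c1 w' : w' \in nonnbs A y -> w' = w by move=> w'c; apply: (card_le1_eqP y1).
    rewrite inE; apply/andP; split; last by apply/forall_inP => w' /c1->.
    apply: contraT => /(Rc _ xA)/setU1P[xy|/c1 xw].
      by move: wy; rewrite /nonadj adjC -xy wx andbF.
    by rewrite xw adjxx in wx.
  have [I2|I3] := leqP #|I| 2.
    have [x1 [x2 [x1W x2W x12 I12]]] := card2_between IW I2 W2.
    move: x1W x2W; rewrite !inE -!andbA.
    move=> /and3P[x1A yx1 /forall_inP wx1] /and3P[x2A yx2 /forall_inP wx2].
    apply: (colorable3_near_universal yA _ _ x12) => //; rewrite ?inE ?x1A ?x2A //.
      by move=> z zR zI; apply: (subsetP I12); rewrite inE zR zI eqxx.
    by move=> w wc; rewrite wx1 ?wx2.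
  have [z zI] : exists z, z \in I by apply/set0Pn; rewrite -card_gt0; lia.
  have degI x : x \in I -> #|nonnbs A x| + 3 = #|A| /\ #|nonnbs A y| = 1.
    move=> xI; have xA : x \in A by have := subsetP IR _ xI; rewrite inE => /andP[].
    have := deg2 x xA; have := card_nbs xA.
    by rewrite nbI // cardsU1 yc /=; lia.
  have [dz cy] := degI z zI.
  have zA : z \in A by have := subsetP IR _ zI; rewrite inE => /andP[].
  (* The vertices in I, at least 3, have degree 2, and the other vertices of R are
     non-adjacent to all of I. With y and its non-neighbour, the count of pairs
     gives 6 n - 22 <= 4 n - 10 if n >= 6. *)
  have A6 : #|A| <= 6.
    have RA : R \subset A by apply/subsetP => x; rewrite inE => /andP[].
    have cRI := cardsID I R; rewrite (setIidPr IR) in cRI.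
    have cAR := cardsID R A; rewrite (setIidPr RA) in cAR.
    have sI : #|I| * (#|A| - 3) <= \sum_(x in I) #|nonnbs A x|.
      by apply: leq_mul_sum => x /degI[]; lia.
    have sRI : #|R :\: I| * 3 <= \sum_(x in R :\: I) #|nonnbs A x|.
      apply: leq_mul_sum => x /setDP[xR xI]; apply: leq_trans I3 _.
      apply/subset_leq_card/subsetP => t tI; rewrite inE (subsetP RA) ?(subsetP IR) //=.
      apply/andP; split; first by apply: contraNneq xI => ->.
      apply/negP => xt; move: tI; rewrite inE => /andP[_ /eqP/setP/(_ x)].
      by rewrite in_setI xR in_set0 andbT inE (subsetP RA _ xR) adjC xt.
    have sAR : #|A :\: R| * 1 <= \sum_(x in A :\: R) #|nonnbs A x|.
      apply: leq_mul_sum => x /setDP[xA /(Rc _ xA)/setU1P[->|xc]]; first by rewrite cy.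
      rewrite card_gt0; apply/set0Pn; exists y; move: xc.
      by rewrite !inE yA nonadjC => /andP[].
    move: hA; rewrite /double_nonedges (big_setID R) /= (setIidPr RA).
    rewrite (big_setID I) /= (setIidPr IR).
    nia.
  have [z' /setD1P[z'z z'I]] : exists z', z' \in I :\ z.
    by apply/set0Pn; rewrite -card_gt0; move: I3; rewrite (cardsD1 z) zI; lia.
  have z'R := subsetP IR _ z'I.
  have IleA : #|I| + 2 <= #|A| by have := subset_leq_card IR; lia.
  apply: (ext z zA); first by lia.
  right; exists z'; last by rewrite !nbI // setIid cardsU1 yc cy.
  move: (zI); rewrite inE => /andP[_ /eqP/setP/(_ z')]; rewrite [_ \in _ :&: _]inE z'R !inE andbT.
  have z'A : z' \in A by move: z'R; rewrite inE => /andP[].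
  by rewrite z'A /nonadj eq_sym z'z /= => ->.
have {no1} con2 x : x \in A -> 1 < #|nonnbs A x|.
  by move=> xA; have := no1 x; rewrite /= xA /= leqNgt => /negbFE.
have [v /andP[vA v2]|no2] := pickP [pred v in A | #|nonnbs A v| <= 2].
  by apply: (ext v vA); [rewrite con2 //= leqW|left].
have {con2 no2} con3 x : x \in A -> 2 < #|nonnbs A x|.
  by move=> xA; have := no2 x; rewrite /= xA /= leqNgt => /negbFE.
(* Hence 3 n <= 4 n - 10, so n >= 10. *)
have s3 : #|A| * 3 <= double_nonedges A by apply: leq_mul_sum.
have [v /andP[vA v3]|no3] := pickP [pred v in A | #|nonnbs A v| <= 3]; last first.
  suff : #|A| * 4 <= double_nonedges A by lia.
  apply: leq_mul_sum => x xA.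
  by have := no3 x; rewrite /= xA /= leqNgt => /negbFE.
have [y /andP[yv y2]|noy] := pickP [pred y in nonnbs A v | 1 < #|nbs A v :&: nbs A y|].
  by apply: (ext v vA); [have := con3 v vA; lia|right; exists y].
(* Each non-neighbour of v has at most 1 common neighbour with v, hence degree at
   most 3, which is too little when n >= 10. *)
have TA : nonnbs A v \subset A by apply/subsetP => x; rewrite inE => /andP[].
have sT : #|nonnbs A v| * (#|A| - 4) <= \sum_(x in nonnbs A v) #|nonnbs A x|.
  apply: leq_mul_sum => x xT; have xA := subsetP TA _ xT.
  suff : #|nbs A x| <= 3 by have := card_nbs xA; lia.
  have := cardsID (nbs A v) (nbs A x).
  have : #|nbs A x :\: nbs A v| <= #|nonnbs A v :\ x|.
    apply/subset_leq_card/subsetP => t; rewrite !inE => /and3P[tv tA xt].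
    rewrite tA /nonadj; move: tv; rewrite tA /= => ->.
    rewrite (eq_sym t) (adj_neq xt) /= andbT; move: xT; rewrite inE => /and3P[_ _].
    by apply: contraNneq => ->; rewrite adjC.
  have := cardsD1 x (nonnbs A v); rewrite xT; have := noy x; rewrite /= xT /= setIC.
  lia.
have sA : #|A :\: nonnbs A v| * 3 <= \sum_(x in A :\: nonnbs A v) #|nonnbs A x|.
  by apply: leq_mul_sum => x /setDP[xA _]; apply: con3.
have cAT := cardsID (nonnbs A v) A; rewrite (setIidPr TA) in cAT.
have v_gt2 := con3 v vA.
move: hA s3; rewrite /double_nonedges (big_setID (nonnbs A v)) /= (setIidPr TA).
nia.
Qed.

(** * From pairs of vertices to edges *)

Lemma double_edges : 2 * #|edges G| <= \sum_x #|nbs [set: G] x|.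
Proof.
pose ends (xy : G * G) := [set xy.1; xy.2].
pose P := [pred xy : G * G | adj xy.1 xy.2].
have -> : \sum_x #|nbs [set: G] x| = \sum_(xy in P) 1.
  rewrite (eq_bigr (fun x => \sum_(y | adj x y) 1)) => [|x _].
    by rewrite pair_big_dep.
  by rewrite -sum1_card; apply: eq_bigl => y; rewrite !inE.
rewrite (partition_big_imset ends) -/(edges G) mulnC -sum_nat_const /=.
apply: leq_sum => f /imsetP[[x y] xy ->]; rewrite /ends /=.
rewrite sum1dep_card.
have <- : #|[set (x, y); (y, x)]| = 2.
  by rewrite cards2 xpair_eqE negb_and (adj_neq xy).
apply/subset_leq_card/subsetP => p; rewrite !inE => /orP[]/eqP-> /=.
  by rewrite eqxx andbT.
by rewrite adjC setUC eqxx andbT.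
Qed.

Lemma double_nonedges_edges :
  double_nonedges [set: G] + 2 * #|edges G| <= #|G| * #|G|.-1.
Proof.
apply: leq_trans (leq_add (leqnn _) double_edges) _; rewrite /double_nonedges.
rewrite (eq_bigl predT) => [|x]; last by rewrite inE.
rewrite -big_split /= -sum_nat_const; apply: leq_sum => x _.
by have := card_nbs (in_setT x); rewrite cardsT addnC => <-.
Qed.

(** For a path [x], [z], [w], [y] the vertices [x] and [w] differ since otherwise
    its first two edges would be the same and so have the same color; likewise
    for [z] and [y]. *)
Lemma rainbow_path c x y : (forall x y, c x y = c y x) -> x != y ->
    rainbow [set: G] c x y ->
  exists2 p, is_path x y p & uniq (pairmap c x p).
Proof.
move=> cC xy [e|z _ xz zy D|z w _ _ xz zw wy U].
- by exists [:: y]; rewrite //; split; rewrite //= ?e // inE xy.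
- exists [:: z; y]; last by rewrite /= inE D.
  by split; rewrite //= ?xz ?zy // !inE negb_or xy (adj_neq xz) (adj_neq zy).
exists [:: z; w; y]; rewrite //; split; rewrite //= ?xz ?zw ?wy //.
move: U => /=; rewrite !inE !negb_or !andbT => /andP[/andP[D1 _] D3].
rewrite (adj_neq xz) xy (adj_neq zw) (adj_neq wy) !andbT /=.
apply/andP; split; first by apply: contraNneq D1 => ->; rewrite (cC z w).
by apply: contraNneq D3 => ->; rewrite (cC y w).
Qed.

Lemma set2_inj x y a b : [set x; y] = [set a; b] ->
  (x = a /\ y = b) \/ (x = b /\ y = a).
Proof.
move=> E.
have : x \in [set a; b] by rewrite -E set21.
have : y \in [set a; b] by rewrite -E set22.
have : a \in [set x; y] by rewrite E set21.
have : b \in [set x; y] by rewrite E set22.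
by rewrite !in_set2 => /orP[]/eqP ? /orP[]/eqP ? /orP[]/eqP ? /orP[]/eqP ?; subst; auto.
Qed.

(** A symmetric function of two vertices is turned into one of edges by choosing
    an order of the two ends. *)
Lemma colorable_rainbow k : colorable k [set: G] -> rainbow_colorable G k.
Proof.
move=> [c [cC ck cG]].
pose c' (f : {set G}) :=
  if [pick xy : G * G | f == [set xy.1; xy.2]] is Some xy then c xy.1 xy.2 else 0.
have c'E x y : c' [set x; y] = c x y.
  rewrite /c'; case: pickP => [[a b] /= /eqP/set2_inj[[-> ->]|[-> ->]] //|/(_ (x, y))].
  by rewrite /= eqxx.
exists c' => [f /imsetP[[x y] _ ->]|x y]; first by rewrite c'E.
have [->|xy] := eqVneq x y; first by exists [::].
have [p xp up] := rainbow_path cC xy (cG x y (in_setT x) (in_setT y) xy).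
exists p => //; suff -> : map c' (path_edges x p) = pairmap c x p by [].
by elim: p x {xy xp up} => //= z p IHp x; rewrite c'E IHp.
Qed.

End Dense.

Theorem theorem2p3 (G : sgraph) (cG : connected G) (n : nat)
    (hn : #|G| = n) (n_ge4 : 4 <= n)
    (hE : 'C(n - 2, 2) + 2 <= #|edges G|) :
  rc cG <= 3.
Proof.
suff G3 : colorable 3 [set: G].
  by rewrite /rc; case: ex_minnP => k _; apply; apply/asboolP/colorable_rainbow.
apply: colorable3_dense => [x _|].
  have /set0Pn[y /setD1P[yx _]] : [set: G] :\ x != set0.
    by rewrite -card_gt0; have := cardsD1 x [set: G]; rewrite inE cardsT; lia.
  have /connectP[[|z p] /=] := cG x y; first by move=> _ xy; rewrite xy eqxx in yx.
  by move=> /andP[xz _] _; rewrite card_gt0; apply/set0Pn; exists z; rewrite !inE.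
have := double_nonedges_edges G; rewrite cardsT hn.
have := mul_bin_diag (n - 2) 1; rewrite bin1.
nia.
Qed.
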